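(* Let $\mathbf{X}$ be a real vector space, $\mathbf{Z}$ a nonempty set, and $\phi:\mathbf{Z}\times\mathbf{X}\to\mathbf{Z}$ a function with $\phi(z,0)=z$ for all $z\in\mathbf{Z}$. Let $f:\mathbf{Z}\to\overline{\mathbb{R}}$ and $(x_0,z_0)\in\mathbf{X}\times\mathbf{Z}$. Then $A^\infty f(z_0)$ is the optimal horizon-independent constant, i.e. the smallest $a\in\overline{\mathbb{R}}$ such that $\mu[f(Z_T)]\le a$ for all integers $T\ge0$ and all $\mu\in\mathcal{M}^T(x_0)$. Moreover, \[ A^\infty f(z_0)=\sup_{\mu\in\mathcal{M}^\infty(x_0)}\mu[f(Z_\infty)]. \]
   Context: $\overline{\mathbb{R}}=[-\infty,\infty]$, with the convention $\infty-\infty=-\infty$, used in particular in the definitions of concavity and integrals. A function $\psi:\mathbf{X}\to\overline{\mathbb{R}}$ is concave if $\psi(\lambda x+(1-\lambda)y)\ge\lambda\psi(x)+(1-\lambda)\psi(y)$ for all $x,y\in\mathbf{X}$, $\lambda\in(0,1)$. For $h:\mathbf{X}\to\overline{\mathbb{R}}$, the concave envelope is $h^\sharp(x)=\inf\{\psi(x)\mid\psi:\mathbf{X}\to\overline{\mathbb{R}}\text{ concave},\ \psi\ge h\}$. For $g:\mathbf{Z}\to\overline{\mathbb{R}}$, $Ag(z)=[g\circ\phi(z,\cdot)]^\sharp(0)$, $z\in\mathbf{Z}$; $A^n$ is the $n$-fold composition of $A$, and $A^\infty f(z)=\lim_{n\to\infty}A^nf(z)$ (the sequence is nondecreasing in $n$,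 so the limit exists in $\overline{\mathbb{R}}$). Given a path $(X_t)_{t=0,1,2,\dots}$ in $\mathbf{X}$ with $X_0=x_0$ (the coordinate process), define $Z_0=z_0$ and $Z_{t+1}=\phi(Z_t,X_{t+1}-X_t)$. A martingale is called simple if its law (on path space) has finite support. $\mathcal{M}^T(x_0)$ is the set of laws of $\mathbf{X}$-valued simple martingales $(M_0,\dots,M_T)$ with $M_0=x_0$; $\mathcal{M}^\infty(x_0)$ is the set of laws of $\mathbf{X}$-valued simple martingales $(M_t)_{t\in\mathbb{N}}$ ($\mathbb{N}\ni 0$) with $M_0=x_0$, where simple means that the support is a finite subset of $\mathbf{X}^{\mathbb{N}}$. Every such infinite-horizon martingale is eventually constant, so $Z_\infty:=\lim_nZ_n$ is well defined $\mu$-a.s. as the eventual constant value of $Z_n$. $\mu[\cdot]$ denotes expectation under $\mu$, with $(X_t)$ the coordinate process; it is a finite sum, equal to $-\infty$ if both positive and negative parts have infinite expectation. *)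

(* Defs.v *)
From HB Require Import structures.
From mathcomp Require Import all_boot all_order all_algebra.
From mathcomp Require Import boolp classical_sets functions cardinality fsbigop.
From mathcomp Require Import reals ereal topology normedtype sequences.

Set Implicit Arguments.
Unset Strict Implicit.
Unset Printing Implicit Defensive.

Import Order.TTheory GRing.Theory Num.Theory.

Local Open Scope classical_set_scope.
Local Open Scope ring_scope.
Local Open Scope ereal_scope.

(* The addition of [\bar R] satisfies [+oo + -oo = -oo], which is the convention
   needed in the definition of concavity and in expectations. *)
Definition concave (R : realType) (X : lmodType R) (psi : X -> \bar R) : Prop :=
  forall (x y : X) (l : R), (0 < l)%R -> (l < 1)%R ->
    l%:E * psi x + (1 - l)%:E * psi y <= psi (l *: x + (1 - l) *: y)%R.

Definition concave_envelope (R : realType) (X : lmodType R) (h : X -> \bar R)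
    (x : X) : \bar R :=
  ereal_inf [set psi x | psi in
    [set psi : X -> \bar R | concave psi /\ forall y, h y <= psi y]].

Definition Aop (R : realType) (X : lmodType R) (Z : Type) (phi : Z -> X -> Z)
    (g : Z -> \bar R) (z : Z) : \bar R :=
  concave_envelope (fun x => g (phi z x)) 0%R.

Definition Ainfty (R : realType) (X : lmodType R) (Z : Type) (phi : Z -> X -> Z)
    (f : Z -> \bar R) (z : Z) : \bar R :=
  lim ((fun n : nat => iter n (Aop phi) f z) @ \oo).

(* A finitely supported law on [W] is represented by its mass function. All sums
   [\sum_(w \in B) _] below are finite sums over the support. *)
Definition simple_law (R : realType) (W : choiceType) (mu : W -> R) : Prop :=
  [/\ finite_set [set w | mu w != 0%R],
      forall w, (0 <= mu w)%R
    & (\sum_(w \in [set: W]) mu w = 1)%R].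

Definition expectation (R : realType) (W : choiceType) (mu : W -> R)
    (Y : W -> \bar R) : \bar R :=
  \sum_(w \in [set: W]) (mu w)%:E * Y w.

(* Conditional mean of a vector-valued [Y] given an event [B] of positive mass. *)
Definition cond_mean (R : realType) (X : lmodType R) (W : choiceType)
    (mu : W -> R) (B : set W) (Y : W -> X) : X :=
  ((\sum_(w \in B) mu w)^-1 *: \sum_(w \in B) mu w *: Y w)%R.

(* Paths are functions [I -> X], where [time : I -> nat] embeds the index set:
   ['I_T.+1] for the horizon [T], [nat] for the infinite horizon. *)
Definition same_history (X I : Type) (time : I -> nat) (s : I) (w : I -> X) :
    set (I -> X) :=
  [set w' | forall r, (time r <= time s)%N -> w' r = w r].

(* [E[X_t | X_0, ..., X_s] = X_s] for [t = s + 1], almost surely; as the law is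
   finitely supported, this is a condition on each atom of the history charged
   by the law. *)
Definition martingale_law (R : realType) (X : lmodType R) (I : Type)
    (time : I -> nat) (mu : (I -> X) -> R) : Prop :=
  forall (s t : I), time t = (time s).+1 ->
  forall w : I -> X, mu w != 0%R ->
    cond_mean mu (same_history time s w) (fun w' => w' t) = w s.

Definition simple_martingales (R : realType) (X : lmodType R) (I : Type)
    (time : I -> nat) (x0 : X) : set ((I -> X) -> R) :=
  [set mu | [/\ simple_law mu,
      forall w i, mu w != 0%R -> time i = 0%N -> w i = x0
    & martingale_law time mu]].

Definition MT (R : realType) (X : lmodType R) (T : nat) (x0 : X) :
    set (('I_T.+1 -> X) -> R) :=
  simple_martingales (@nat_of_ord T.+1) x0.

Definition Minfty (R : realType) (X : lmodType R) (x0 : X) :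
    set ((nat -> X) -> R) :=
  simple_martingales (fun n : nat => n) x0.

Fixpoint state (R : realType) (X : lmodType R) (Z : Type) (phi : Z -> X -> Z)
    (z0 : Z) (w : nat -> X) (t : nat) : Z :=
  if t is t'.+1 then phi (state phi z0 w t') (w t'.+1 - w t')%R else z0.

(* [Z_T] only reads the path at times at most [T], where [inord] is faithful. *)
Definition terminal_state (R : realType) (X : lmodType R) (Z : Type)
    (phi : Z -> X -> Z) (z0 : Z) (T : nat) (w : 'I_T.+1 -> X) : Z :=
  state phi z0 (fun t => w (inord t)) T.

(* The eventual constant value of [Z_n]; the default [z0] is only taken on paths
   along which [Z_n] is not eventually constant. *)
Definition limit_state (R : realType) (X : lmodType R) (Z : Type)
    (phi : Z -> X -> Z) (z0 : Z) (w : nat -> X) : Z :=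
  xget (z0 : {classic Z})
    [set z : {classic Z} | \forall n \near \oo, state phi z0 w n = z].

(* Main.v *)
(* Let G_n(z) be the supremum of E[f(Z_n)] over the simple martingales of horizon
   n; as Z only reads increments it does not depend on the starting point.
   Upper bound: given the past up to time s, Jensen's inequality for any concave
   majorant of g(phi(Z_s, .)) yields E[g(Z_{s+1})] <= E[(A g)(Z_s)], hence
   E[f(Z_n)] <= A^n f(z_0).
   Lower bound: let psi(y) be the supremum of E[f(Z_{n+1})] over the processes
   started at x whose first increment has mean y and which are martingales from
   time 1 on. Mixing laws shows that psi is concave, moving first from x to x + y
   shows that psi(y) >= G_n(phi(z, y)), and psi(0) = G_{n+1}(z); so
   A G_n <= G_{n+1}.
   Finally, finitely many paths are pairwise separated by some time N, after
   which the past determines the whole path and a martingale is constant. *)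

Require Import Defs.
From HB Require Import structures.
From mathcomp Require Import all_boot all_order all_algebra.
From mathcomp Require Import boolp classical_sets functions cardinality fsbigop.
From mathcomp Require Import reals ereal topology normedtype sequences.

Set Implicit Arguments.
Unset Strict Implicit.
Unset Printing Implicit Defensive.

Import Order.TTheory GRing.Theory Num.Theory.

Local Open Scope classical_set_scope.
Local Open Scope ring_scope.
Local Open Scope ereal_scope.

(** * Sums grouped by a key, and arithmetic in [\bar R] *)

Lemma partition_big_undup (T : Type) (idx : T) (op : Monoid.com_law idx)
    (I : Type) (J : eqType) (s : seq I) (k : I -> J) (F : I -> T) :
  \big[op/idx]_(i <- s) F i =
  \big[op/idx]_(j <- undup (map k s)) \big[op/idx]_(i <- s | k i == j) F i.
Proof.
under [RHS]eq_bigr do rewrite big_mkcond.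
rewrite exchange_big /=.
suff H s' : {subset map k s' <= undup (map k s)} ->
    \big[op/idx]_(i <- s') F i = \big[op/idx]_(i <- s')
      \big[op/idx]_(j <- undup (map k s)) (if k i == j then F i else idx).
  by apply: H => j; rewrite mem_undup.
elim: s' => [|i s' IHs'] ks; first by rewrite !big_nil.
rewrite !big_cons -IHs'; last by move=> j js; apply: ks; rewrite /= inE js orbT.
congr (op _ _); rewrite -big_mkcond /= -big_filter.
have kis : k i \in undup (map k s) by apply: ks; rewrite /= inE eqxx.
by rewrite (eq_filter (a2 := pred1 (k i))) ?filter_pred1_uniq ?undup_uniq ?big_seq1.
Qed.

(** The convention [+oo + -oo = -oo] survives scaling by [r > 0], and for [r = 0] both sides vanish;
    this is what makes means affine under mixing. *)
Lemma muleDr_ge0 (R : realType) (r : R) (x y : \bar R) : (0 <= r)%R ->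
  r%:E * (x + y) = r%:E * x + r%:E * y.
Proof.
rewrite le_eqVlt => /predU1P[<-|r0]; first by rewrite !mul0e adde0.
have [xy|] := boolP (x +? y); first by rewrite muleDr.
by case: x y => [x| |] [y| |] //= _;
  rewrite !(gt0_muley, gt0_muleNy) ?lte_fin ?addNye ?addeNy // gt0_muleNy ?lte_fin.
Qed.

Lemma mule_sumr_ge0 (R : realType) (I : Type) (s : seq I) (P : pred I) (r : R)
    (F : I -> \bar R) : (0 <= r)%R ->
  r%:E * (\sum_(i <- s | P i) F i) = \sum_(i <- s | P i) r%:E * F i.
Proof.
move=> r0; elim/big_rec2: _ => [|i y1 y2 _ <-]; first by rewrite mule0.
by rewrite muleDr_ge0.
Qed.

Lemma sum_mule_all (R : realType) (I : Type) (s : seq I) (c : I -> R) (v : \bar R) :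
  all (fun i => 0 < c i)%R s ->
  \sum_(i <- s) (c i)%:E * v = (\sum_(i <- s) c i)%:E * v.
Proof.
move=> c0; rewrite -sumEFin -(all_filterP c0) !big_filter ge0_sume_distrl //.
by move=> i i0; rewrite lee_fin ltW.
Qed.

Lemma mule_sup_add_le (R : realType) (l : R) (A : set (\bar R)) (c d : \bar R) :
  (0 < l)%R -> (forall a, A a -> l%:E * a + d <= c) ->
  l%:E * ereal_sup A + d <= c.
Proof.
move=> l0 Ac; case: d Ac => [d| |] Ac; last by rewrite addeNy leNye.
  rewrite -leeBrDr // -(@lee_pdivlMl _ l) //.
  apply: ge_ereal_sup => a Aa.
  by rewrite lee_pdivlMl // leeBrDr // Ac.
(* The case [d = +oo]: if [A] contains at most [-oo], the left side is [-oo] by convention; any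
   other element of [A] forces [c = +oo]. *)
have [ANy|/existsNP[a /not_implyP[Aa aNy]]] := pselect (A `<=` [set -oo]).
  by rewrite (ereal_sup_ninfty A).2 // gt0_muleNy ?lte_fin // addNye leNye.
apply: le_trans (Ac _ Aa); rewrite [leRHS]addey ?leey //.
by case: a aNy {Aa} => [a| |] //= _; rewrite ?gt0_muley ?lte_fin.
Qed.

(* A finite law is encoded by a list of weighted points, repetitions being
   allowed, so that mixing is concatenation and pushing forward is [map]. *)
Section FiniteLaws.
Variables (R : realType) (W : Type).
Implicit Types (L M : seq (R * W)) (l : R).

Definition mean L (Y : W -> \bar R) : \bar R := \sum_(p <- L) p.1%:E * Y p.2.

Definition is_law L := all (fun p => (0 < p.1)%R) L /\ (\sum_(p <- L) p.1 = 1)%R.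

Definition mix l L M : seq (R * W) :=
  [seq (l * p.1, p.2)%R | p <- L] ++ [seq ((1 - l) * p.1, p.2)%R | p <- M].

Lemma mean_mix l L M Y : (0 < l)%R -> (l < 1)%R ->
  mean (mix l L M) Y = l%:E * mean L Y + (1 - l)%:E * mean M Y.
Proof.
move=> l0 l1; rewrite /mean big_cat !big_map !mule_sumr_ge0 ?subr_ge0 // 1?ltW //.
by congr (_ + _); apply: eq_bigr => p _; rewrite EFinM muleA.
Qed.

Lemma is_law_mix l L M : (0 < l)%R -> (l < 1)%R ->
  is_law L -> is_law M -> is_law (mix l L M).
Proof.
move=> l0 l1 [L0 L1] [M0 M1]; split; last first.
  by rewrite big_cat !big_map /= -!mulr_sumr L1 M1 !mulr1 addrC subrK.
rewrite all_cat !all_map; apply/andP; split.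
  by apply: sub_all L0 => p /= p0; rewrite mulr_gt0.
by apply: sub_all M0 => p /= p0; rewrite mulr_gt0 ?subr_gt0.
Qed.

Lemma sumZ_mix (X : lmodType R) l L M (P : pred W) (F : W -> X) :
  (\sum_(p <- mix l L M | P p.2) p.1 *: F p.2 =
   l *: \sum_(p <- L | P p.2) p.1 *: F p.2 +
   (1 - l) *: \sum_(p <- M | P p.2) p.1 *: F p.2)%R.
Proof.
rewrite big_cat !big_map !scaler_sumr; congr (_ + _)%R;
by apply: eq_bigr => p _; rewrite scalerA.
Qed.

(** Means are affine under [mix]; the two suprema are removed one at a time by [mule_sup_add_le]. *)
Lemma concave_sup_mean (X : lmodType R) (S : X -> set (seq (R * W)))
    (Y : W -> \bar R) :
  (forall x y l L M, (0 < l)%R -> (l < 1)%R -> S x L -> S y M ->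
     S (l *: x + (1 - l) *: y)%R (mix l L M)) ->
  concave (fun x => ereal_sup [set mean L Y | L in S x]).
Proof.
move=> mixS x y l l0 l1; apply: mule_sup_add_le => // _ [L SL <-].
rewrite addeC; apply: mule_sup_add_le; first by rewrite subr_gt0.
move=> _ [M SM <-]; rewrite addeC -mean_mix //.
by apply: ereal_sup_ubound; exists (mix l L M) => //; apply: mixS.
Qed.

End FiniteLaws.

(** * Jensen's inequality in [\bar R] *)

Lemma sumr_gt0_all (R : realType) (I : Type) (s : seq I) (c : I -> R) :
  (0 < size s)%N -> all (fun i => 0 < c i)%R s -> (0 < \sum_(i <- s) c i)%R.
Proof.
elim: s => [//|i s IHs] _ /= /andP[ci0 cs]; rewrite big_cons.
have [/size0nil ->|s0] := posnP (size s); first by rewrite big_nil addr0.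
by rewrite addr_gt0 // IHs.
Qed.

(** Jensen's inequality with unnormalized weights: the head is combined with the barycenter of the
    tail, with coefficients [c i / (c i + w)] and [w / (c i + w)], where [w] is the tail weight. *)
Lemma concave_sum_le (R : realType) (X : lmodType R) (psi : X -> \bar R)
    (I : Type) (s : seq I) (c : I -> R) (y : I -> X) :
  concave psi -> (0 < size s)%N -> all (fun i => 0 < c i)%R s ->
  \sum_(i <- s) (c i)%:E * psi (y i) <= (\sum_(i <- s) c i)%:E *
    psi ((\sum_(i <- s) c i)^-1 *: \sum_(i <- s) c i *: y i)%R.
Proof.
move=> cpsi; elim: s => [//|i s IHs] _ /= /andP[ci0 cs].
have [/size0nil ->|s0] := posnP (size s).
  by rewrite !big_seq1 scalerA mulVf ?gt_eqF // scale1r.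
rewrite !big_cons; apply: le_trans (leeD2l _ (IHs s0 cs)) _.
set w := (\sum_(j <- s) c j)%R; set v := (\sum_(j <- s) _)%R.
have w0 : (0 < w)%R by apply: sumr_gt0_all.
have cw0 : (0 < c i + w)%R by rewrite addr_gt0.
have wE : (1 - c i / (c i + w) = w / (c i + w))%R.
  by rewrite -{1}(divff (lt0r_neq0 cw0)) -mulrBl addrC addKr.
have lt1 : (c i / (c i + w) < 1)%R by rewrite ltr_pdivrMr // mul1r ltrDl.
have J := cpsi (y i) (w^-1 *: v)%R _ (divr_gt0 ci0 cw0) lt1.
rewrite -(@lee_pmul2l _ (c i + w)%:E) // wE muleDr_ge0 ?(ltW cw0) // !muleA -!EFinM in J.
move: J; rewrite ![((c i + w) * (_ / _))%R]mulrC !divfK ?gt_eqF //.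
by rewrite scalerA mulrAC divff ?gt_eqF // mul1r scalerDr scalerA (mulrC (c i)).
Qed.

Lemma ge_concave_envelope (R : realType) (X : lmodType R) (h : X -> \bar R) x :
  h x <= concave_envelope h x.
Proof. by apply: le_ereal_inf_tmp => _ [psi [_ hpsi] <-]. Qed.

(** The martingale property is an unnormalized sum of increments: linear in the weights, and an
    empty sum on histories that no path of [L] shares. *)
Definition list_martingale (R : realType) (X : lmodType R) (I : Type)
    (time : I -> nat) (x0 : X) (L : seq (R * (I -> X))) : Prop :=
  [/\ is_law L,
      {in L, forall p i, time i = 0%N -> p.2 i = x0}
    & forall s t, time t = (time s).+1 -> forall w : I -> X,
        (\sum_(p <- L | p.2 \in same_history time s w)
           p.1 *: (p.2 t - p.2 s) = 0)%R].

Notation same_past := (same_history (fun n : nat => n)).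
Notation path_martingale := (list_martingale (fun n : nat => n)).

(** * Upper bound: evolution of the state over one step *)

Section Dynamics.
Variables (R : realType) (X : lmodType R) (Z : Type) (phi : Z -> X -> Z).
Implicit Types (w : nat -> X) (L : seq (R * (nat -> X))).

Lemma eq_state z w w' n : (forall r, (r <= n)%N -> w r = w' r) ->
  state phi z w n = state phi z w' n.
Proof.
elim: n => [//|n IHn] ww' /=; rewrite IHn => [|r rn]; last exact/ww'/leqW.
by rewrite !ww'.
Qed.

(** Turns sharing a past up to time [s] into equality of keys, so that [partition_big_undup] can
    condition on the past. *)
Definition stopped s w : nat -> X := fun r => w (minn r s).

Lemma stoppedE s w w' : (stopped s w' == stopped s w) = (w' \in same_past s w).
Proof.
apply/eqP/idP => [ww'|/set_mem ww'].
  by apply/mem_set => r rs; move: (congr1 (@^~ r) ww'); rewrite /stopped (minn_idPl rs).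
by apply/funext => r; apply: ww'; apply: geq_minr.
Qed.

Lemma mean_state_step x0 L (g : Z -> \bar R) z s : path_martingale x0 L ->
  mean L (fun w => g (state phi z w s.+1)) <=
  mean L (fun w => Aop phi g (state phi z w s)).
Proof.
move=> [[L0 _] _ Lm]; rewrite /mean.
rewrite (partition_big_undup _ _ (fun p => stopped s p.2)).
rewrite [leRHS](partition_big_undup _ _ (fun p => stopped s p.2)).
rewrite big_seq [leRHS]big_seq; apply: lee_sum => j.
rewrite mem_undup => /mapP[p0 p0L ->{j}].
under eq_bigl do rewrite stoppedE; under [leRHS]eq_bigl do rewrite stoppedE.
rewrite -big_filter -[leRHS]big_filter; set C := [seq p <- L | _].
have C0 : all (fun p => 0 < p.1)%R C.
  by apply/allP => p; rewrite mem_filter => /andP[_]; apply: (allP L0).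
have sC : (0 < size C)%N.
  by rewrite size_filter -has_count; apply/hasP; exists p0 => //; apply/mem_set.
have stC p : p \in C -> state phi z p.2 s = state phi z p0.2 s.
  by rewrite mem_filter => /andP[/set_mem pp0 _]; apply: eq_state.
set z' := state phi z p0.2 s in stC.
rewrite [leRHS](eq_big_seq (fun p => p.1%:E * Aop phi g z')); last first.
  by move=> p /stC /= ->.
rewrite [leLHS](eq_big_seq
    (fun p => p.1%:E * g (phi z' (p.2 s.+1 - p.2 s)%R))); last first.
  by move=> p /stC /= ->.
have W0 := sumr_gt0_all sC C0.
(* Isolating the envelope on the right makes it enough to compare with each of its concave majorants
   [psi]. *)
rewrite sum_mule_all // -lee_pdivrMl //.
apply: le_ereal_inf_tmp => _ [psi [cpsi gpsi] <-].
rewrite lee_pdivrMl //.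
apply: (@le_trans _ _ (\sum_(p <- C) p.1%:E * psi (p.2 s.+1 - p.2 s)%R)).
  rewrite big_seq [leRHS]big_seq; apply: lee_sum => p pC.
  by rewrite lee_pmul2l // lte_fin (allP C0).
apply: le_trans (concave_sum_le (fun p => p.2 s.+1 - p.2 s)%R cpsi sC C0) _.
(* The martingale property puts the barycenter in Jensen's inequality at [0], where the envelope in
   [Aop] is evaluated. *)
by rewrite [X in (_^-1 *: X)%R]big_filter Lm // scaler0.
Qed.

(** The induction generalizes [f]: peeling off the last step replaces [f] by [Aop phi f]. *)
Lemma mean_state_le x0 L (f : Z -> \bar R) z n : path_martingale x0 L ->
  mean L (fun w => f (state phi z w n)) <= iter n (Aop phi) f z.
Proof.
move=> mL; elim: n f => [|n IHn] f; last first.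
  by rewrite iterSr; apply: le_trans (IHn _); apply: mean_state_step mL.
have [[L0 L1] _ _] := mL.
by rewrite /mean /= sum_mule_all // L1 mul1e.
Qed.

(** * Lower bound: laws with a prescribed mean of the first increment *)

Definition settled n w := forall r, (n <= r)%N -> w r = w n.

(* The conditions are linear in the law once [x] and [n] are fixed, which makes the
   mean [y] of the first increment an affine parameter under mixing. *)
Definition steered_martingale (x y : X) n L : Prop :=
  [/\ is_law L,
      {in L, forall p, p.2 0%N = x /\ settled n p.2},
      (\sum_(p <- L | xpredT p.2) p.1 *: (p.2 1%N - p.2 0%N) = y)%R
    & forall s w, (\sum_(p <- L | p.2 \in same_past s.+1 w)
        p.1 *: (p.2 s.+2 - p.2 s.+1) = 0)%R].

Lemma steered_martingale_mix x y y' l n L M : (0 < l)%R -> (l < 1)%R ->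
  steered_martingale x y n L -> steered_martingale x y' n M ->
  steered_martingale x (l *: y + (1 - l) *: y')%R n (mix l L M).
Proof.
move=> l0 l1 [Llaw Lx Ly Lm] [Mlaw Mx My Mm]; split.
- exact: is_law_mix.
- by move=> p; rewrite mem_cat => /orP[] /mapP[q qL ->] /=; [apply: Lx|apply: Mx].
- by rewrite (sumZ_mix _ _ _ xpredT (fun w => w 1%N - w 0%N)%R) Ly My.
- move=> s w.
  rewrite (sumZ_mix _ _ _ (mem (same_past s.+1 w)) (fun w => w s.+2 - w s.+1)%R).
  by rewrite Lm Mm !scaler0 addr0.
Qed.

Lemma steered_martingale0 x n L : steered_martingale x 0%R n L -> path_martingale x L.
Proof.
move=> [Llaw Lx L0 Lm]; split=> // [p pL i ->|[|s] t -> w].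
- by case: (Lx p pL).
(* All paths of [L] start at [x], so a history at time 0 collects either the whole of [L] or
   nothing. *)
- have [wx|wx] := eqVneq (w 0%N) x.
    rewrite -[RHS]L0 big_seq_cond [RHS]big_seq_cond; apply: eq_bigl => p.
    have [pL|//] := boolP (p \in L).
    rewrite mem_set //= => r; rewrite leqn0 => /eqP ->.
    by rewrite wx; case: (Lx p pL).
  rewrite big1_seq // => p /andP[/set_mem/(_ 0%N)/(_ (leqnn 0))/= p0 pL].
  by move: wx; rewrite -p0; case: (Lx p pL) => ->; rewrite eqxx.
- exact: Lm.
Qed.

Definition prepend x w : nat -> X := fun t => if t is t'.+1 then w t' else x.

Lemma state_prepend x w z n :
  state phi z (prepend x w) n.+1 = state phi (phi z (w 0%N - x)%R) w n.
Proof. by elim: n => [//|n IHn]; rewrite /= -IHn. Qed.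

(** A sure jump from [x] to [x + y] comes first; the later conditions are those of [L] shifted by
    one time unit. *)
Lemma steered_martingale_prepend x y n L : path_martingale (x + y)%R L ->
  {in L, forall p, settled n p.2} ->
  steered_martingale x y n.+1 [seq (p.1, prepend x p.2) | p <- L].
Proof.
move=> [[L0 L1] Lx Lm] Ln; split.
- by split; [rewrite all_map|rewrite big_map].
- by move=> _ /mapP[p pL ->]; split=> // -[//|r] /= nr; apply: Ln.
- rewrite big_map /= big_seq (eq_bigr (fun p => p.1 *: y)%R).
    by rewrite -big_seq -scaler_suml L1 scale1r.
  by move=> p pL; rewrite (Lx p pL) // addrAC subrr add0r.
move=> s w; rewrite big_map /=.
have [wx|wx] := eqVneq (w 0%N) x; last first.
  rewrite big1 // => p /set_mem/(_ 0%N)/(_ isT)/= px.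
  by move: wx; rewrite -px eqxx.
rewrite -[RHS](Lm s s.+1 erefl (fun t => w t.+1)); apply: eq_bigl => p.
apply/idP/idP => /set_mem pw; apply/mem_set.
  by move=> r rs; apply: (pw r.+1).
by move=> [|r] rs //=; apply: pw.
Qed.

(** Laws of horizon [n] live on infinite paths frozen after time [n], so that they serve both the
    finite and the infinite horizon. The induction covers all [x] and [z], being applied at [x + y]
    and [phi z y]. *)
Lemma iter_Aop_le_sup (f : Z -> \bar R) n x z :
  iter n (Aop phi) f z <=
  ereal_sup [set mean L (fun w => f (state phi z w n)) | L in
    [set L | path_martingale x L /\ {in L, forall p, settled n p.2}]].
Proof.
elim: n x z => [|n IHn] x z.
  apply: ereal_sup_ubound; exists [:: (1%R, fun=> x)].
    split; last by move=> p; rewrite inE => /eqP -> r.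
    split; first by split; rewrite ?big_seq1 //= ltr01.
      by move=> p; rewrite inE => /eqP ->.
    move=> s t _ w; rewrite big1_seq // => p /andP[_].
    by rewrite inE => /eqP ->; rewrite subrr scaler0.
  by rewrite /mean big_seq1 mul1e.
rewrite iterS; pose psi y := ereal_sup
  [set mean L (fun w => f (state phi z w n.+1)) | L in steered_martingale x y n.+1].
apply: (@le_trans _ _ (psi 0%R)).
  apply: ereal_inf_lbound; exists psi => //; split.
    apply: concave_sup_mean => *; exact: steered_martingale_mix.
  move=> y; apply: le_trans (IHn (x + y)%R (phi z y)) _.
  apply: ge_ereal_sup => _ [L [Lm Ln] <-].
  apply: ereal_sup_ubound; exists [seq (p.1, prepend x p.2) | p <- L].
    exact: steered_martingale_prepend.
  rewrite /mean big_map; apply: eq_big_seq => p pL.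
  have [_ Lx _] := Lm.
  by rewrite state_prepend (Lx p pL) // addrAC subrr add0r.
apply: ereal_sup_le => _ [L SL <-]; exists L => //; split.
  exact: steered_martingale0 SL.
by case: SL => _ Lx _ _ p /Lx[].
Qed.

End Dynamics.

(** * Passage between weighted lists and mass functions *)

Section Mass.
Variables (R : realType) (W : choiceType).
Implicit Types (L : seq (R * W)) (B : set W).

Definition mass L (w : W) : R := (\sum_(p <- L | p.2 == w) p.1)%R.

Lemma mass_ge0 L w : all (fun p => 0 < p.1)%R L -> (0 <= mass L w)%R.
Proof.
move=> L0; rewrite /mass big_seq_cond sumr_ge0 // => p /andP[pL _].
by rewrite ltW // (allP L0).
Qed.

Lemma mass_neq0 L w : all (fun p => 0 < p.1)%R L ->
  (mass L w != 0%R) = (w \in [seq p.2 | p <- L]).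
Proof.
move=> L0; apply/idP/idP => [|/mapP[p pL wp]].
  apply: contraNT => wL; rewrite /mass big1_seq // => p /andP[/eqP pw pL].
  by move: wL; rewrite -pw map_f.
rewrite gt_eqF // /mass -big_filter; apply: sumr_gt0_all.
  by rewrite size_filter -has_count; apply/hasP; exists p => //=; rewrite wp.
by apply/allP => q; rewrite mem_filter => /andP[_]; apply: (allP L0).
Qed.

(** One statement for real, vector and [\bar R] valued sums: [h] is additive on nonnegative weights,
    which merges the repetitions of an atom. *)
Lemma fsbig_mass (T : Type) (idx : T) (op : Monoid.com_law idx)
    (h : R -> W -> T) L B : all (fun p => 0 < p.1)%R L ->
  (forall w, h 0%R w = idx) ->
  (forall a b w, (0 <= a)%R -> (0 <= b)%R -> h (a + b)%R w = op (h a w) (h b w)) ->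
  \big[op/idx]_(w \in B) h (mass L w) w = \big[op/idx]_(p <- L | p.2 \in B) h p.1 p.2.
Proof.
move=> L0 h0 hD; rewrite -[in LHS](set_mem_set B).
rewrite -(@bigfs _ _ _ _ (undup [seq p.2 | p <- L])) ?undup_uniq //; last first.
  by move=> w _; rewrite mem_undup -mass_neq0 // negbK => /eqP ->.
rewrite big_mkcond [RHS]big_mkcond [RHS](partition_big_undup _ _ (fun p => p.2)).
apply: eq_bigr => w _.
rewrite [LHS](_ : _ = if w \in B then h (mass L w) w else idx) //.
rewrite [RHS](eq_bigr (fun p => if w \in B then h p.1 w else idx)) => [|p /eqP ->] //.
case: ifP => _; last by rewrite big1.
elim: L L0 => [|p L IHL] /=; first by rewrite /mass !big_nil.
move=> /andP[p0 L0]; rewrite /mass !big_cons; case: ifP => _; last exact: IHL.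
by rewrite hD ?(ltW p0) -?IHL //; apply: mass_ge0.
Qed.

Lemma expectation_mass L (Y : W -> \bar R) : all (fun p => 0 < p.1)%R L ->
  expectation (mass L) Y = mean L Y.
Proof.
move=> L0; rewrite /expectation (fsbig_mass _ (h := fun a w => a%:E * Y w)) //.
- by apply: eq_bigl => p; rewrite in_setT.
- by move=> w; rewrite mul0e.
- by move=> a b w a0 b0; rewrite EFinD ge0_muleDl.
Qed.

Lemma simple_law_mass L : is_law L -> simple_law (mass L).
Proof.
move=> [L0 L1]; split; last 1 first.
- rewrite (fsbig_mass _ (h := fun a w => a)) // -[RHS]L1.
  by apply: eq_bigl => p; rewrite in_setT.
- apply: sub_finite_set (finite_seq [seq p.2 | p <- L]) => w /=.
  by rewrite mass_neq0.
- by move=> w; apply: mass_ge0.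
Qed.

Lemma simple_law_massP (mu : W -> R) : simple_law mu ->
  exists2 L, is_law L & mass L = mu.
Proof.
move=> [/finite_seqP[r rE] mu0 mu1].
(* [undup] matters: a repeated entry would double the mass of its atom. *)
pose L := [seq (mu w, w) | w <- undup r].
have rP w : (w \in undup r) = (mu w != 0%R).
  have rw : is_true (mu w != 0%R) = (w \in r) := congr1 (@^~ w) rE.
  by rewrite mem_undup; apply/idP/idP; rewrite rw.
have L0 : all (fun p => 0 < p.1)%R L.
  by rewrite all_map; apply/allP => w /=; rewrite rP lt_def mu0 andbT.
have muE : mass L = mu.
  apply/funext => w; rewrite /mass big_map /=.
  have [wD|] := boolP (w \in undup r).
    rewrite -big_filter (eq_filter (a2 := pred1 w)) // filter_pred1_uniq ?undup_uniq //.
    by rewrite big_seq1.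
  move=> wD; have := wD; rewrite rP negbK => /eqP ->.
  by rewrite big1_seq // => v /andP[/eqP ->]; rewrite (negbTE wD).
exists L => //; split=> //.
rewrite -mu1 -muE (fsbig_mass _ (h := fun a w => a)) //.
by apply: eq_bigl => p; rewrite in_setT.
Qed.

End Mass.

(** * Martingale laws as lists, change of horizon, eventual constancy *)

Section Martingales.
Variables (R : realType) (X : lmodType R).

(** The event contains a charged path, so its mass [c] is positive; as [p.2 s = w s] there, the sum
    of increments is [c] times the gap between the conditional mean and [w s]. *)
Lemma cond_mean_mass (I : Type) (time : I -> nat) (L : seq (R * (I -> X)))
    (s t : I) (w : I -> X) :
  all (fun p => 0 < p.1)%R L -> w \in [seq p.2 | p <- L] ->
  cond_mean (mass L) (same_history time s w) (fun w' => w' t) = w s <->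
  (\sum_(p <- L | p.2 \in same_history time s w) p.1 *: (p.2 t - p.2 s) = 0)%R.
Proof.
move=> L0 /mapP[p0 p0L wp0]; rewrite /cond_mean.
rewrite (fsbig_mass _ (h := fun a w' => a)) //.
rewrite (fsbig_mass _ (h := fun a (w' : I -> X) => a *: w' t)%R) //; last first.
- by move=> a b w' _ _; rewrite scalerDl.
- by move=> w'; rewrite scale0r.
set c := (\sum_(p <- L | _) p.1)%R; set S := (\sum_(p <- L | _) _ *: p.2 t)%R.
have c0 : (0 < c)%R.
  rewrite /c -big_filter; apply: sumr_gt0_all.
    rewrite size_filter -has_count; apply/hasP; exists p0 => //.
    by apply/mem_set; rewrite wp0.
  by apply/allP => q; rewrite mem_filter => /andP[_]; apply: (allP L0).
have -> : (\sum_(p <- L | p.2 \in same_history time s w) p.1 *: (p.2 t - p.2 s) =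
    S - c *: w s)%R.
  rewrite /S /c scaler_suml -sumrB; apply: eq_bigr => p /set_mem pw.
  by rewrite scalerBr (pw s).
split=> [<-|/subr0_eq ->]; first by rewrite scalerA divff ?gt_eqF // scale1r subrr.
by rewrite scalerA mulVf ?gt_eqF // scale1r.
Qed.

Lemma simple_martingales_mass (I : Type) (time : I -> nat) (x0 : X)
    (L : seq (R * (I -> X))) : is_law L ->
  simple_martingales time x0 (mass L) <-> list_martingale time x0 L.
Proof.
move=> Llaw; have [L0 _] := Llaw; split=> [[_ Lx Lm]|[_ Lx Lm]]; split=> //.
- by move=> p pL i i0; apply: Lx => //; rewrite mass_neq0 // map_f.
- move=> s t st w.
  (* A history shared with some path of [L] is the history of that charged path; otherwise the sum
     is empty. *)
  have [/hasP[p pL /set_mem pw]|/hasPn Lw] :=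
      boolP (has (fun p => p.2 \in same_history time s w) L); last first.
    by rewrite big1_seq // => p /andP[pw /Lw]; rewrite pw.
  have -> : same_history time s w = same_history time s p.2.
    by apply/seteqP; split=> w' ww' r rs; rewrite ww' // pw.
  have pL2 : p.2 \in [seq q.2 | q <- L] by rewrite map_f.
  by apply/(cond_mean_mass _ _ _ L0 pL2)/Lm => //; rewrite mass_neq0.
- exact: simple_law_mass.
- by move=> w i; rewrite mass_neq0 // => /mapP[p pL ->]; apply: Lx.
- by move=> s t st w; rewrite mass_neq0 // => wL; apply/cond_mean_mass => //; apply: Lm.
Qed.

Definition extend T (w : 'I_T.+1 -> X) : nat -> X := fun t => w (inord (minn t T)).

Lemma path_martingale_extend T x0 (L : seq (R * ('I_T.+1 -> X))) :
  list_martingale (@nat_of_ord T.+1) x0 L ->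
  path_martingale x0 [seq (p.1, extend p.2) | p <- L].
Proof.
move=> [[L0 L1] Lx Lm]; split; first by split; [rewrite all_map|rewrite big_map].
  move=> _ /mapP[p pL ->] i /= ->.
  by rewrite /extend min0n Lx //= inordK.
move=> s _ -> w; rewrite big_map /extend /=.
have [Ts|sT] := leqP T s.
  rewrite big1 // => p _.
  by rewrite (minn_idPr (leqW Ts)) subrr scaler0.
rewrite (minn_idPl sT).
rewrite -[RHS](Lm (inord s) (inord s.+1) _ (fun i => w i)); last first.
  by rewrite !inordK // leqW.
apply: eq_bigl => p; apply/idP/idP => /set_mem pw; apply/mem_set.
  move=> r; rewrite inordK ?leqW // => rs.
  by rewrite -pw // (minn_idPl _) ?inord_val // -ltnS.
move=> r /= rs; have rT := leq_ltn_trans rs sT.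
by rewrite (minn_idPl (ltnW rT)) pw ?inordK // ltnS ltnW.
Qed.

Lemma list_martingale_restrict n x0 (L : seq (R * (nat -> X))) :
  path_martingale x0 L ->
  list_martingale (@nat_of_ord n.+1) x0
    [seq (p.1, (fun i : 'I_n.+1 => p.2 i)) | p : R * (nat -> X) <- L].
Proof.
move=> [[L0 L1] Lx Lm]; split; first by split; [rewrite all_map|rewrite big_map].
  by move=> _ /mapP[p pL ->] i /= ->; apply: Lx.
move=> s t st w; rewrite big_map /= st.
rewrite -[RHS](Lm s s.+1 erefl (fun t => w (inord t))).
apply: eq_bigl => p; apply/idP/idP => /set_mem pw; apply/mem_set.
  move=> r /= rs; have rn := leq_ltn_trans rs (ltn_ord s).
  by rewrite -pw inordK.
by move=> r rs; rewrite pw // inord_val.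
Qed.

Lemma finite_paths_separated (L : seq (R * (nat -> X))) :
  exists N, forall p q, p \in L -> q \in L ->
    (forall r, (r <= N)%N -> p.2 r = q.2 r) -> p.2 = q.2.
Proof.
(* [d] picks a time at which a pair of distinct paths differs; its maximum over pairs from [L] is
   the witness [N]. *)
have /choice[d dP] (ww : (nat -> X) * (nat -> X)) :
    exists n, ww.1 n = ww.2 n -> ww.1 = ww.2.
  have [/existsNP[n wn]|ww'] := pselect (~ forall n, ww.1 n = ww.2 n); first by exists n.
  by exists 0%N => _; apply/funext; apply: contrapT.
exists (\max_(p <- L) \max_(q <- L) d (p.2, q.2)) => p q pL qL pq.
apply: (dP (p.2, q.2)); apply: pq.
apply: leq_trans (leq_bigmax_seq (F := fun q => d (p.2, q.2)) q qL isT) _.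
exact: (leq_bigmax_seq (F := fun p => \max_(q <- L) d (p.2, q.2)) p pL isT).
Qed.

Lemma path_martingale_settled x0 (L : seq (R * (nat -> X))) :
  path_martingale x0 L -> exists N, {in L, forall p, settled N p.2}.
Proof.
move=> [[L0 _] _ Lm]; have [N LN] := finite_paths_separated L.
exists N => p pL r; elim: r => [|r IHr]; first by rewrite leqn0 => /eqP ->.
rewrite leq_eqVlt => /predU1P[->//|Nr]; rewrite -IHr //.
apply/subr0_eq/eqP; have /eqP := Lm r r.+1 erefl p.2.
(* Beyond time [N], the paths of [L] sharing the past of [p] equal [p.2], so the sum is a positive
   multiple of a single increment. *)
rewrite -big_filter (eq_big_seq (fun q => q.1 *: (p.2 r.+1 - p.2 r))%R).
  rewrite -scaler_suml scaler_eq0 gt_eqF //; apply: sumr_gt0_all.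
    by rewrite size_filter -has_count; apply/hasP; exists p => //; apply/mem_set.
  by apply/allP => q; rewrite mem_filter => /andP[_]; apply: (allP L0).
move=> q; rewrite mem_filter => /andP[/set_mem qp qL].
by rewrite (LN q p) // => i iN; apply: qp; apply: leq_trans iN Nr.
Qed.

End Martingales.

(** * Limits of states and of iterates of [Aop] *)

Lemma limit_state_settled (R : realType) (X : lmodType R) (Z : Type)
    (phi : Z -> X -> Z) (phi0 : forall z, phi z 0%R = z) z N (w : nat -> X) :
  settled N w -> limit_state phi z w = state phi z w N.
Proof.
move=> wN.
have stN n : (N <= n)%N -> state phi z w n = state phi z w N.
  elim: n => [|n IHn]; first by rewrite leqn0 => /eqP ->.
  rewrite leq_eqVlt => /predU1P[->//|Nn] /=.
  by rewrite IHn // !wN // ?subrr ?phi0 // leqW.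
rewrite /limit_state; apply: (@xget_unique {classic Z}); first by exists N.
move=> y [M _ My]; have := My (maxn M N) (leq_maxl _ _).
by rewrite /= stN // leq_maxr.
Qed.

Section Limit.
Variables (R : realType) (X : lmodType R) (Z : Type) (phi : Z -> X -> Z).

(** As [phi z 0 = z], the envelope at [0] dominates [g z], so [g <= Aop phi g] and the iterates
    increase to their supremum. *)
Lemma Ainfty_sup (phi0 : forall z, phi z 0%R = z) (f : Z -> \bar R) z :
  Ainfty phi f z = ereal_sup (range (fun n => iter n (Aop phi) f z)).
Proof.
apply/cvg_lim => //; apply: ereal_nondecreasing_cvgn.
apply/nondecreasing_seqP => n; rewrite iterS.
have := ge_concave_envelope (fun x => iter n (Aop phi) f (phi z x)) 0%R.
by rewrite /= phi0.
Qed.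

Lemma iter_Aop_le_Ainfty (phi0 : forall z, phi z 0%R = z) (f : Z -> \bar R) z n :
  iter n (Aop phi) f z <= Ainfty phi f z.
Proof. by rewrite Ainfty_sup //; apply: ereal_sup_ubound; exists n. Qed.

End Limit.

Theorem mainTheorem3 (R : realType) (X : lmodType R) (Z : Type)
    (phi : Z -> X -> Z) (phi0 : forall z : Z, phi z 0%R = z)
    (f : Z -> \bar R) (x0 : X) (z0 : Z) :
  ((forall (T : nat) (mu : ('I_T.+1 -> X) -> R), MT x0 mu ->
      expectation mu (fun w => f (terminal_state phi z0 w)) <= Ainfty phi f z0)
   /\ (forall a : \bar R,
        (forall (T : nat) (mu : ('I_T.+1 -> X) -> R), MT x0 mu ->
           expectation mu (fun w => f (terminal_state phi z0 w)) <= a) ->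
        Ainfty phi f z0 <= a))
  /\ Ainfty phi f z0 =
     ereal_sup [set expectation mu (fun w => f (limit_state phi z0 w))
               | mu in Minfty x0].
Proof.
split; first split.
- move=> T mu muM; have [mulaw _ _] := muM.
  have [L Llaw muE] := simple_law_massP mulaw; move: muM; rewrite -muE.
  move=> /(simple_martingales_mass _ _ Llaw) /path_martingale_extend ML.
  apply: le_trans (iter_Aop_le_Ainfty phi0 f z0 T).
  apply: le_trans (mean_state_le phi f z0 T ML).
  rewrite expectation_mass; last by case: Llaw.
  rewrite /mean big_map le_eqVlt; apply/orP; left; apply/eqP.
  apply: eq_bigr => p _; congr (_ * f _); apply: eq_state => r rT.
  by rewrite /= /extend (minn_idPl rT).
- move=> a aM; rewrite Ainfty_sup //; apply: ge_ereal_sup => _ [n _ <-].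
  apply: le_trans (iter_Aop_le_sup phi f n x0 z0) _.
  (* Cutting the paths at time [n] gives a law of horizon [n] with the same state at that time. *)
  apply: ge_ereal_sup => _ [L [/(list_martingale_restrict n) ML _] <-].
  have [Llaw _ _] := ML.
  have /(_ n _ (proj2 (simple_martingales_mass _ _ Llaw) ML)) := aM.
  rewrite expectation_mass; last by case: Llaw.
  rewrite /mean big_map; congr (_ <= _).
  apply: eq_bigr => p _; congr (_ * f _); apply: eq_state => r rn.
  by rewrite /= inordK.
apply/eqP; rewrite eq_le; apply/andP; split.
  rewrite Ainfty_sup //; apply: ge_ereal_sup => _ [n _ <-].
  apply: le_trans (iter_Aop_le_sup phi f n x0 z0) _.
  (* On paths settled at [n] the limit state is the state at time [n], so the same law competes on
     the infinite horizon. *)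
  apply: ereal_sup_le => _ [L [ML Ln] <-]; have [Llaw _ _] := ML.
  exists (mass L); first exact/simple_martingales_mass.
  rewrite expectation_mass; last by case: Llaw.
  by apply: eq_big_seq => p pL; rewrite (limit_state_settled phi0 _ (Ln p pL)).
apply: ge_ereal_sup => _ [mu muM <-]; have [mulaw _ _] := muM.
have [L Llaw muE] := simple_law_massP mulaw; move: muM; rewrite -muE.
move=> /(simple_martingales_mass _ _ Llaw) ML.
(* A common settling time [N] of the finitely many paths turns the limit state into the state at
   time [N]. *)
have [N LN] := path_martingale_settled ML.
apply: le_trans (iter_Aop_le_Ainfty phi0 f z0 N).
apply: le_trans (mean_state_le phi f z0 N ML).
rewrite expectation_mass; last by case: Llaw.
rewrite le_eqVlt; apply/orP; left; apply/eqP.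
by apply: eq_big_seq => p pL; rewrite (limit_state_settled phi0 _ (LN p pL)).
Qed.
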